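(* Let $X_f$ be a random vector in $\mathbb{R}^n$ and $h:\mathbb{R}^n\to\mathbb{R}^d$ an observation operator such that $X_f$ and $h(X_f)$ have finite second moments, and let $R\in\mathbb{R}^{d\times d}$ be a nonsingular covariance matrix (i.e. symmetric positive definite). Let $\Sigma_{xx}=\operatorname{Cov}[X_f]$, $\Sigma_{xh}=\operatorname{Cov}[X_f,h(X_f)]$, $\Sigma_{hh}=\operatorname{Cov}[h(X_f)]$, let $Z_f=X_f-\mathbb{E}[X_f]$, $W_f=h(X_f)-\mathbb{E}[h(X_f)]$, and let $$\Sigma_a=\Sigma_{xx}-\Sigma_{xh}(R+\Sigma_{hh})^{-1}\Sigma_{xh}^{T},\qquad K(s)=\Sigma_{xh}\big((s+1)R+\Sigma_{hh}\big)^{-1}\quad (s>0).$$ Define a probability density $p(s)=[\pi\sqrt{s}\,(s+1)]^{-1}$ over $s\in(0,\infty)$. If $$Z_a=Z_f-\int_0^\infty p(s)\,K(s)\,W_f\,ds,$$ then $\mathbb{E}[Z_a]=0$ and $\operatorname{Cov}[Z_a]=\Sigma_a$.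
   Context: For random vectors $U,V$, $\operatorname{Cov}[U,V]=\mathbb{E}[(U-\mathbb{E}U)(V-\mathbb{E}V)^T]$ and $\operatorname{Cov}[U]=\operatorname{Cov}[U,U]$. The matrix $\Sigma_a$ is called the Kalman filter analysis covariance, for the observation model $Y=h(X_f)+E_0$ with $E_0\sim\mathcal{N}(0,R)$ independent of $X_f$. The matrix $K(s)$ is the Kalman gain with observation errors inflated by $s$. Integrals of matrix-valued functions are taken entrywise. *)

(* Defs.v *)
From HB Require Import structures.
From mathcomp Require Import all_boot all_order all_algebra.
From mathcomp Require Import all_classical all_reals all_analysis.

Set Implicit Arguments.
Unset Strict Implicit.
Unset Printing Implicit Defensive.

Import Order.TTheory GRing.Theory Num.Theory.
Import numFieldNormedType.Exports.

Local Open Scope classical_set_scope.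
Local Open Scope ring_scope.

(* Random vectors of R^k are functions into column vectors, on a probability
   space (T, P); measurability is part of the membership of the components
   in Lfun P 2. *)
Definition finite_second_moments (disp : measure_display)
    (T : measurableType disp) (R : realType) (P : probability T R) (k : nat)
    (U : T -> 'cV[R]_k) : Prop :=
  forall i : 'I_k, (fun w => U w i 0) \in Lfun P 2%:E.

(* An entry whose expectation is infinite or undefined gets a junk value; only
   meaningful when all entries are integrable. *)
Definition mx_expectation (disp : measure_display) (T : measurableType disp)
    (R : realType) (P : probability T R) (m k : nat)
    (U : T -> 'M[R]_(m, k)) : 'M[R]_(m, k) :=
  \matrix_(i, j) fine ('E_P[(fun w => U w i j)])%E.

Definition mx_covariance (disp : measure_display) (T : measurableType disp)
    (R : realType) (P : probability T R) (m k : nat)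
    (U : T -> 'cV[R]_m) (V : T -> 'cV[R]_k) : 'M[R]_(m, k) :=
  mx_expectation P (fun w =>
    (U w - mx_expectation P U) *m (V w - mx_expectation P V)^T).

Definition mx_integrable (R : realType) (D : set R) (m k : nat)
    (F : R -> 'M[R]_(m, k)) : Prop :=
  forall i j,
    (@lebesgue_measure R).-integrable D (fun s => (F s i j)%:E).

Definition mx_integral (R : realType) (D : set R) (m k : nat)
    (F : R -> 'M[R]_(m, k)) : 'M[R]_(m, k) :=
  \matrix_(i, j) \int[@lebesgue_measure R]_(s in D) F s i j.

Definition sym_posdef (R : realType) (k : nat) (A : 'M[R]_k) : Prop :=
  A^T = A /\ forall x : 'cV[R]_k, x != 0 -> 0 < (x^T *m A *m x) 0 0.

Definition probability_density_on (R : realType) (D : set R) (p : R -> R) :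
    Prop :=
  [/\ measurable_fun D p,
      (forall s, D s -> 0 <= p s) &
      (\int[@lebesgue_measure R]_(s in D) (p s)%:E = 1)%E].

(* Main.v *)
Require Import Defs.
From HB Require Import structures.
From mathcomp Require Import all_boot all_order all_algebra.
From mathcomp Require Import all_classical all_reals all_analysis.
From mathcomp Require Import measurable_realfun ring.
From mathcomp Require spectral sesquilinear mxred complex.

Set Implicit Arguments.
Unset Strict Implicit.
Unset Printing Implicit Defensive.

Import Order.TTheory GRing.Theory Num.Theory.
Import numFieldNormedType.Exports.

Local Open Scope classical_set_scope.
Local Open Scope ring_scope.

(* Write N = R^-1 S_hh.  It is self-adjoint for the inner product x^T R y,
   so N = Q^-1 diag(l) Q with Q real and l >= 0, and
   ((s + 1) R + S_hh)^-1 = phi_s(N) R^-1 with phi_s(x) = 1 / (s + 1 + x).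
   Integrating against p turns phi_s into m(x) = 1 / (q (q + 1)), q = sqrt(1 + x),
   hence Z_a = Z_f - S_xh M W_f where M = m(N) R^-1 is symmetric.  Therefore
   Cov[Z_a] = S_xx - S_xh (2 M - M S_hh M) S_xh^T, and the scalar identity
   2 m(x) - m(x)^2 x = 1 / (1 + x) says that 2 M - M S_hh M = (R + S_hh)^-1. *)

(** * Real diagonalization of a symmetric pencil [(A, H)] with [A] positive definite *)

Section pencil_diag.
Import spectral sesquilinear mxred complex.
Local Open Scope sesquilinear_scope.

Lemma hermsymmxP (C : numClosedFieldType) n (A : 'M[C]_n) :
  A ^t* = A <-> A \is hermsymmx.
Proof.
split=> [hA | /is_hermitianmxP].
  by apply/is_hermitianmxP; rewrite expr0 scale1r hA.
by rewrite expr0 scale1r => {2}->.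
Qed.

Lemma trmxC_mul (C : numClosedFieldType) m n p (A : 'M[C]_(m, n))
  (B : 'M[C]_(n, p)) : (A *m B) ^t* = B ^t* *m A ^t*.
Proof. by rewrite trmx_mul map_mxM. Qed.

(* [B^-* H B^-1] is Hermitian and similar to [(B^* B)^-1 H]. *)
Lemma herm_pencil_diagonalizable (C : numClosedFieldType) n (B H : 'M[C]_n) :
  B \in unitmx -> H ^t* = H ->
  exists P d, [/\ P \in unitmx, d \is a mxOver Num.real &
    P *m (invmx (B ^t* *m B) *m H) = diag_mx d *m P].
Proof.
move=> Bu Hh; pose G := invmx B ^t* *m H *m invmx B.
have BtB : (invmx B) ^t* *m B ^t* = 1%:M.
  by rewrite -trmxC_mul mulmxV// trmx1 map_mx1.
have Gh : G \is hermsymmx.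
  by apply/hermsymmxP; rewrite /G !trmxC_mul trmxCK Hh mulmxA.
have /orthomx_spectralP := hermitian_normalmx Gh.
set V := spectralmx G; set d := spectral_diag G => GE.
have Vu : V \in unitmx by exact: spectral_unit.
(* [V] diagonalizes [G], and [G = B ((B^* B)^-1 H) B^-1], so [V B] diagonalizes the pencil. *)
exists (V *m B), d; split; first by rewrite unitmx_mul Vu.
  exact: hermitian_spectral_diag_real.
have -> : diag_mx d = V *m G *m invmx V.
  by rewrite GE !mulmxA mulmxV// mul1mx mulmxK.
rewrite !mulmxA mulmxKV// /G.
have BCu : B ^t* \in unitmx by case/mulmx1_unit : BtB.
have -> : invmx (B ^t* *m B) = invmx B *m (invmx B) ^t*.
  apply: (can_inj (mulKmx (_ : B ^t* *m B \in unitmx))).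
    by rewrite unitmx_mul BCu.
  by rewrite mulmxV ?unitmx_mul ?BCu// mulmxA mulmxK// (mulmx1C BtB).
by rewrite !mulmxA !mulmxK// !mulmxKV.
Qed.

Section real.
Variable R : rcfType.
Local Notation f := (real_complex R).

Lemma trmxC_real_complex m n (A : 'M[R]_(m, n)) :
  (map_mx f A) ^t* = map_mx f A^T.
Proof.
by apply/matrixP => i j; rewrite !mxE; apply/CrealP; rewrite complex_real.
Qed.

(** With [A = V^-1 diag(d) V] and [V] unitary, [B = diag(sqrt d) V] works, since the entries of
    [sqrt d] are real. [B] is complex because [V] comes from the spectral theorem over [R[i]]. *)
Lemma symmx_posdef_factor n (A : 'M[R]_n) :
  A^T = A -> (forall x : 'cV[R]_n, x != 0 -> 0 < (x^T *m A *m x) 0 0) ->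
  exists2 B : 'M[R[i]]_n, B \in unitmx & map_mx f A = B ^t* *m B.
Proof.
move=> As Ap; pose A' := map_mx f A.
have Ah : A' \is hermsymmx by apply/hermsymmxP; rewrite trmxC_real_complex As.
have /orthomx_spectralP := hermitian_normalmx Ah.
have := spectral_unitarymx A'.
set V := spectralmx A'; set d := spectral_diag A' => Vun AE.
have Vu : V \in unitmx by exact: unitarymx_unit.
have VA : V *m A' = diag_mx d *m V.
  by rewrite {1}AE -mulmxA mulKVmx.
(* Positivity of [A] is assumed on real vectors only. The eigenvalue is real, hence also an
   eigenvalue of [A] over [R], and a real eigenvector can be tested. *)
have d0 i : 0 < d 0 i.
  have dr : d 0 i \is Num.real.
    by move/mxOverP : (hermitian_spectral_diag_real Ah); apply.
  have [r rE] := complex_realP _ dr.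
  have : eigenvalue A' (f r).
    apply/eigenvalueP; exists (row i V).
      rewrite -row_mul VA -rE; apply/rowP => j.
      by rewrite mul_diag_mx !mxE.
    apply/eqP => r0.
    have : row i (V *m invmx V) = 0 by rewrite row_mul r0 mul0mx.
    rewrite mulmxV// => /rowP/(_ i); rewrite !mxE eqxx => /eqP.
    by rewrite oner_eq0.
  rewrite eigenvalue_map => /eigenvalueP[v vE v0].
  have := Ap v^T.
  rewrite trmxK vE -scalemxAl mxE -(inj_eq trmx_inj) trmxK trmx0 => /(_ v0).
  rewrite rE ltcR; apply: contraTT; rewrite -!leNgt => r0.
  rewrite mulr_le0_ge0// mxE sumr_ge0// => j _.
  by rewrite mxE -expr2 sqr_ge0.
pose e := map_mx sqrtC d.
have eE : diag_mx e *m diag_mx e = diag_mx d.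
  rewrite mulmx_diag; congr diag_mx; apply/rowP => i.
  by rewrite !mxE -expr2 sqrtCK.
have eu : diag_mx e \in unitmx.
  rewrite unitmxE det_diag unitfE; apply/prodf_neq0 => i _.
  by rewrite mxE sqrtC_eq0 gt_eqF.
exists (diag_mx e *m V); first by rewrite unitmx_mul eu.
have eh : (diag_mx e) ^t* = diag_mx e.
  rewrite tr_diag_mx map_diag_mx; congr diag_mx; apply/rowP => i.
  by rewrite !mxE; apply/CrealP/ger0_real; rewrite sqrtC_ge0 ltW.
by rewrite trmxC_mul eh !mulmxA -(mulmxA (V ^t*)) eE -invmx_unitary.
Qed.

(** The complex diagonalization has a real spectrum, so it is a similarity over [R[i]] between two
    real matrices; [real_similar] then yields a change of basis with real entries. *)
Lemma pencil_diagonalizable n (A H : 'M[R]_n) :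
  A^T = A -> (forall x : 'cV[R]_n, x != 0 -> 0 < (x^T *m A *m x) 0 0) ->
  H^T = H ->
  exists P d, P \in unitmx /\ P *m (invmx A *m H) = diag_mx d *m P.
Proof.
move=> As Ap Hs; have [B Bu AB] := symmx_posdef_factor As Ap.
have := @herm_pencil_diagonalizable _ _ B (map_mx f H) Bu.
rewrite trmxC_real_complex Hs -AB => /(_ erefl)[P [d [Pu dr PE]]].
pose r : 'rV[R]_n := map_mx (@complex.Re R) d.
have dE : d = map_mx f r.
  by apply/matrixP => i j; rewrite !mxE RRe_real//; exact: (mxOverP dr).
have : similar_in unitmx (map_mx f (invmx A *m H)) (map_mx f (diag_mx r)).
  exists P => //; apply/similarP => //.
  by rewrite map_mxM map_invmx map_diag_mx -dE.
move=> /real_similar[||Q].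
- by apply/mxOverP => i j; rewrite mxE complex_real.
- by apply/mxOverP => i j; rewrite mxE complex_real.
rewrite inE => /andP[/= /mxOverP Qr Qu] /(similarP Qu) QE.
pose Q' : 'M[R]_n := map_mx (@complex.Re R) Q.
have Q'E : Q = map_mx f Q'.
  by apply/matrixP => i j; rewrite !mxE RRe_real.
exists Q', r; split; first by rewrite -(map_unitmx f) -Q'E.
by apply: (map_mx_inj (f := f)); rewrite !map_mxM -Q'E -!map_mxM.
Qed.

End real.
End pencil_diag.

(** A nonzero row [x] of the left kernel would give [x A x^T = 0]. *)
Lemma posdef_unitmx (R : realFieldType) n (A : 'M[R]_n) :
  (forall x : 'cV[R]_n, x != 0 -> 0 < (x^T *m A *m x) 0 0) -> A \in unitmx.
Proof.
move=> Ap; rewrite -row_free_unit -kermx_eq0; apply/eqP/row_matrixP => i.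
rewrite row0; apply/eqP; apply: contraT => x0.
have := Ap (row i (kermx A))^T; rewrite trmxK -trmx_eq0 trmxK => /(_ x0).
by rewrite -row_mul mulmx_ker row0 mul0mx mxE ltxx.
Qed.

(** * Functional calculus for the diagonalized pencil *)

Section pencil.
Context {R : realFieldType} {n : nat}.
Variables (A H P : 'M[R]_n) (d : 'rV[R]_n).
Hypotheses (As : A^T = A) (Au : A \in unitmx) (Hs : H^T = H).
Hypotheses (Pu : P \in unitmx) (PE : P *m (invmx A *m H) = diag_mx d *m P).

(* Functional calculus: [g] applied to [invmx A *m H], times [invmx A]. *)
Definition pencil_fun (g : R -> R) : 'M[R]_n :=
  invmx P *m diag_mx (map_mx g d) *m (P *m invmx A).

(** The row [x = row i P] is a left eigenvector of [A^-1 H]. With [y = A^-1 x^T] this reads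
    [y^T H y = d_i (y^T A y)], so [d_i] is a quotient of a nonnegative number by a positive one. *)
Lemma pencil_eig_ge0 :
  (forall x : 'cV[R]_n, x != 0 -> 0 < (x^T *m A *m x) 0 0) ->
  (forall x : 'cV[R]_n, 0 <= (x^T *m H *m x) 0 0) ->
  forall i, 0 <= d 0 i.
Proof.
move=> Ap Hp i; set x := row i P.
pose y := invmx A *m x^T.
have yT : y^T = x *m invmx A by rewrite trmx_mul trmxK trmx_inv As.
have xN : x *m (invmx A *m H) = d 0 i *: x.
  by rewrite -row_mul PE; apply/rowP => j; rewrite mul_diag_mx !mxE.
have y0 : y != 0.
  apply/eqP => y0.
  have : x *m invmx P = 0.
    by rewrite -[x](mulmxKV Au) -yT y0 trmx0 !mul0mx.
  rewrite -row_mul mulmxV// => /rowP/(_ i); rewrite !mxE eqxx => /eqP.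
  by rewrite oner_eq0.
have := Hp y; rewrite yT -(mulmxA x) xN -scalemxAl mxE.
have := Ap _ y0; rewrite yT mulmxKV// => xy0.
by rewrite pmulr_lge0.
Qed.

(** [c A + H = A P^-1 (c + diag d) P], where only the diagonal factor depends on [c]. *)
Lemma pencil_fun_inv (c : R) : (forall i, c + d 0 i != 0) ->
  c *: A + H \in unitmx /\
  invmx (c *: A + H) = pencil_fun (fun x => (c + x)^-1).
Proof.
move=> cd.
have E : (c *: A + H) *m pencil_fun (fun x => (c + x)^-1) = 1%:M.
  have -> : c *: A + H = A *m invmx P *m (c%:M + diag_mx d) *m P.
    rewrite mulmxDr mulmxDl mul_mx_scalar -!scalemxAl mulmxKV//; congr (_ + _).
    by rewrite -!mulmxA -PE mulKmx// mulKVmx.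
  rewrite /pencil_fun !mulmxA mulmxK// -!mulmxA (mulmxA (_ + _)).
  have -> : (c%:M + diag_mx d) *m diag_mx (map_mx (fun x => (c + x)^-1) d) =
      1%:M.
    rewrite -diag_const_mx -raddfD mulmx_diag -diag_const_mx; congr diag_mx.
    by apply/rowP => i; rewrite !mxE divff.
  by rewrite mul1mx mulKmx// mulmxV.
have [Xu _] := mulmx1_unit E; split => //.
by rewrite -[LHS]mulmx1 -E mulKmx.
Qed.

(* [P A^-1 P^T] commutes with [diag_mx d], hence with every function of it. *)
Lemma tr_pencil_fun g : (pencil_fun g)^T = pencil_fun g.
Proof.
pose S := P *m invmx A *m P^T.
have Ss : S^T = S by rewrite /S !trmx_mul trmxK trmx_inv As mulmxA.
have DS : diag_mx d *m S = S *m diag_mx d.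
  (* This form of [diag(d) S] is visibly symmetric, so it equals its transpose [S diag(d)]. *)
  have E : diag_mx d *m S = P *m invmx A *m H *m invmx A *m P^T.
    by rewrite /S !mulmxA -PE !mulmxA.
  have DSs : (diag_mx d *m S)^T = diag_mx d *m S.
    by rewrite E !trmx_mul !trmxK !trmx_inv As Hs !mulmxA.
  by rewrite -DSs trmx_mul Ss tr_diag_mx.
have gS : diag_mx (map_mx g d) *m S = S *m diag_mx (map_mx g d).
  (* Entrywise, [S_ij (d_i - d_j) = 0]: either [S_ij] vanishes or [g] takes the same value at [d_i]
     and [d_j]. *)
  rewrite mul_diag_mx mul_mx_diag; apply/matrixP => i j; rewrite !mxE.
  have := congr1 (fun M : 'M[R]_n => M i j) DS.
  rewrite mul_diag_mx mul_mx_diag !mxE mulrC => /eqP.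
  rewrite -subr_eq0 -mulrBr mulf_eq0 subr_eq0 => /orP[/eqP->|/eqP->].
    by rewrite mulr0 mul0r.
  by rewrite mulrC.
have -> : pencil_fun g =
    invmx P *m (diag_mx (map_mx g d) *m S) *m (invmx P)^T.
  by rewrite /pencil_fun /S trmx_inv !mulmxA mulmxK ?unitmx_tr.
rewrite trmx_mul trmxK {1}gS trmx_mul [(S *m _)^T]trmx_mul Ss tr_diag_mx.
by rewrite -!mulmxA.
Qed.

(** With [N = A^-1 H], the left side is [g1(N) N g2(N) A^-1]: the inserted [H] cancels one [A^-1]
    and leaves the factor [x]. *)
Lemma pencil_fun_mulH g1 g2 :
  pencil_fun g1 *m H *m pencil_fun g2 = pencil_fun (fun x => g1 x * x * g2 x).
Proof.
rewrite /pencil_fun -!mulmxA; congr (_ *m _).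
rewrite (mulmxA _ H) (mulmxA P) PE -!mulmxA mulKVmx// !mulmxA !mulmx_diag.
by congr (diag_mx _ *m _ *m _); apply/rowP => i; rewrite !mxE.
Qed.

Lemma pencil_funB g1 g2 :
  pencil_fun g1 - pencil_fun g2 = pencil_fun (fun x => g1 x - g2 x).
Proof.
rewrite /pencil_fun -mulmxBl -mulmxBr -raddfB.
by congr (_ *m diag_mx _ *m _); apply/rowP => i; rewrite !mxE.
Qed.

Lemma eq_pencil_fun g1 g2 : (forall i, g1 (d 0 i) = g2 (d 0 i)) ->
  pencil_fun g1 = pencil_fun g2.
Proof.
by move=> g12; congr (_ *m diag_mx _ *m _); apply/rowP => i; rewrite !mxE.
Qed.

End pencil.

(** * The scalar integrals against the density [p] *)

Section integrals.
Context {R : realType}.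
Implicit Types f F : R -> R.

Lemma bigcup_itvcy_invn :
  \bigcup_k `[(k.+1%:R : R)^-1, +oo[%classic = `]0, +oo[%classic.
Proof.
apply/seteqP; split=> [x [k _] /=|x /=]; rewrite !in_itv/= !andbT.
  by apply: lt_le_trans; rewrite invr_gt0.
move=> x0; exists (Num.truncn x^-1) => //=.
rewrite in_itv/= andbT invf_ple ?posrE//.
by apply/ltW; rewrite truncnS_gt.
Qed.

Lemma continuous_measurable_itv0y f :
  (forall x : R, 0 < x -> {for x, continuous f}) ->
  measurable_fun (`]0, +oo[ : set R) f.
Proof.
move=> cf; apply: open_continuous_measurable_fun => // x.
by rewrite inE/= in_itv/= andbT; exact: cf.
Qed.

(* [f] may blow up at [0]: the fundamental theorem of calculus is used on the
   closed half-lines [[1 / k, +oo[], followed by monotone convergence. *)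
Lemma ge0_integral_itv0y f F (l0 l : R) :
  (forall x : R, 0 < x -> 0 <= f x) ->
  (forall x : R, 0 < x -> {for x, continuous f}) ->
  (forall x : R, 0 < x -> is_derive x 1 F (f x)) ->
  F x @[x --> 0^'+] --> l0 -> F x @[x --> +oo%R] --> l ->
  (\int[lebesgue_measure]_(x in `]0%R, +oo[) (f x)%:E = (l - l0)%:E)%E.
Proof.
move=> f0 cf dF Fl0 Fl.
pose a k : R := (k.+1%:R)^-1.
have a0 k : 0 < a k by rewrite invr_gt0.
have mf := continuous_measurable_itv0y cf.
have sub k : `[a k, +oo[ `<=` `]0, +oo[%classic.
  by apply: subset_itvr; rewrite bnd_simp.
have E k : (\int[lebesgue_measure]_(x in `[a k, +oo[) (f x)%:E =
    l%:E - (F (a k))%:E)%E.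
  have cF x : 0 < x -> {for x, continuous F}.
    move=> x0; apply: differentiable_continuous; apply/derivable1_diffP.
    by case: (dF _ x0).
  apply: ge0_continuous_FTC2y => //.
  - by move=> x ax; apply: f0; exact: lt_le_trans ax.
  - apply/continuous_within_itvcyP; split => [x|].
      by rewrite in_itv/= andbT => ax; apply: cf; exact: lt_trans ax.
    by apply: cvg_at_right_filter; exact: cf.
  - by move=> x ax; case: (dF x (lt_trans (a0 k) ax)).
  - by apply: cvg_at_right_filter; exact: cF.
  - move=> x; rewrite in_itv/= andbT => ax.
    by rewrite derive1E; apply: derive_val; apply: dF; exact: lt_trans ax.
have := @ge0_nondecreasing_set_cvg_integral _ (measurableTypeR R) R
  (fun k => `[a k, +oo[%classic) (EFin \o f) lebesgue_measure.
rewrite bigcup_itvcy_invn => H.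
have {}H : (\int[lebesgue_measure]_(x in `[a k, +oo[) (f x)%:E @[k --> \oo] -->
    \int[lebesgue_measure]_(x in `]0%R, +oo[) (f x)%:E)%E.
  apply: H => //.
  - apply/nondecreasing_seqP => k; rewrite subsetEset; apply: subset_itvr.
    by rewrite bnd_simp lef_pV2 ?posrE// ler_nat.
  - by move=> k; apply/measurable_EFinP; exact: measurable_funS mf.
  - by move=> k x /sub /=; rewrite in_itv/= andbT lee_fin; exact: f0.
move: H; under eq_cvg do rewrite E.
move=> /cvg_unique; apply => //.
rewrite EFinB; apply: cvgeB => //; first exact: cvg_cst.
apply: cvg_EFin; first exact: nearW.
by apply: ((cvg_at_rightP F 0 l0).1 Fl0 a); split => //; exact: cvg_harmonic.
Qed.

Lemma cvgry_sqrt : Num.sqrt x @[x --> pinfty_nbhs R] --> pinfty_nbhs R.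
Proof.
apply/cvgryPge => A; near=> x.
have [A0|/ltW A0] := leP A 0; first by rewrite (le_trans A0)// sqrtr_ge0.
rewrite -(ger0_norm A0) -sqrtr_sqr; apply: ler_wsqrtr.
by near: x; apply: nbhs_pinfty_ge; exact: num_real.
Unshelve. all: by end_near. Qed.

Lemma cvg_atan_sqrt0 (a : R) : atan (a * Num.sqrt x) @[x --> 0^'+] --> (0 : R).
Proof.
apply: cvg_at_right_filter.
rewrite -[X in _ --> X](_ : atan (a * Num.sqrt 0) = _); last first.
  by rewrite sqrtr0 mulr0 atan0.
apply: continuous_comp; last exact: continuous_atan.
by apply: cvgM; [exact: cvg_cst | exact: sqrt_continuous].
Qed.

Lemma cvg_atan_sqrty (a : R) : 0 < a ->
  atan (a * Num.sqrt x) @[x --> +oo%R] --> pi / 2.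
Proof.
move=> a0; apply: (cvg_comp _ _ _ (@cvgy_atan R)).
exact: gt0_cvgMry cvgry_sqrt.
Qed.

(** Building block of the antiderivatives below: [a = 1] produces the pole at [-1], and [a = q^-1]
    the pole at [- q^2]. *)
Lemma is_derive_atan_sqrt (a x : R) : 0 < x ->
  is_derive x 1 (fun x => atan (a * Num.sqrt x))
    (a / (2 * Num.sqrt x * (1 + a ^+ 2 * x))).
Proof.
move=> x0; have s0 : 0 < Num.sqrt x by rewrite sqrtr_gt0.
have sE : Num.sqrt x ^+ 2 = x by rewrite sqr_sqrtr// ltW.
have D := is_derive1_sqrt x0.
have D1 := is_deriveZ a D.
have D2 := @is_derive1_comp R (@atan R) (a \*: @Num.sqrt R) x _ _
  (is_derive1_atan _) D1.
apply: (is_derive_eq D2); rewrite -[_ *: _]/(_ * _) exprMn sE.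
by field; rewrite !gt_eqF// ltr_pwDl// mulr_ge0// ?sqr_ge0// ltW.
Qed.

Definition pdens (x : R) : R := (pi * Num.sqrt x * (x + 1))^-1.

Lemma pdens_ge0 (x : R) : 0 < x -> 0 <= pdens x.
Proof.
by move=> x0; rewrite invr_ge0 !mulr_ge0// ?pi_ge0// addr_ge0// ltW.
Qed.

Lemma continuous_addV (c x : R) : 0 < c + x ->
  {for x, continuous (fun x => (x + c)^-1)}.
Proof.
move=> x0; apply: cvgV; first by rewrite addrC gt_eqF.
by apply: cvgD; [exact: cvg_id|exact: cvg_cst].
Qed.

Lemma continuous_pdens (x : R) : 0 < x -> {for x, continuous pdens}.
Proof.
move=> x0; apply: cvgV.
  by rewrite !mulf_neq0// gt_eqF// ?pi_gt0// ?sqrtr_gt0// addr_gt0.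
apply: cvgM; last by apply: cvgD; [exact: cvg_id|exact: cvg_cst].
by apply: cvgM; [exact: cvg_cst | exact: sqrt_continuous].
Qed.

Lemma integral_pdens :
  (\int[lebesgue_measure]_(x in `]0%R, +oo[) (pdens x)%:E = 1)%E.
Proof.
(* Substituting [x = u^2] turns the density into [2 / (pi (1 + u^2))]. The factor [1] matches
   [is_derive_atan_sqrt] at [a = 1]. *)
pose F (x : R) := 2 / pi * atan (1 * Num.sqrt x).
have := @ge0_integral_itv0y _ F 0 1 pdens_ge0 continuous_pdens.
rewrite subr0; apply.
- move=> x x0.
  apply: (is_derive_eq (is_deriveZ (2 / pi) (is_derive_atan_sqrt 1 x0))).
  rewrite -[_ *: _]/(_ * _) /pdens.
  have s0 : 0 < Num.sqrt x by rewrite sqrtr_gt0.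
  have := pi_gt0 R; move: pi => c c0.
  by field; rewrite !gt_eqF ?addr_gt0.
- rewrite -[X in _ --> X](mulr0 (2 / pi)).
  by apply: cvgM; [exact: cvg_cst|exact: cvg_atan_sqrt0].
- have -> : 1 = 2 / pi * (pi / 2) :> R.
    by rewrite mulrA divfK ?divff// gt_eqF ?pi_gt0.
  by apply: cvgM; [exact: cvg_cst|exact: cvg_atan_sqrty].
Qed.

(** Here [q^2] stands for [1 + l], with [l >= 0] an eigenvalue of the pencil. In [u = sqrt x] the
    integrand is [2 / (pi (1 + u^2) (q^2 + u^2))], with a double pole when [q = 1]. *)
Lemma integral_pdens_resolvent (q : R) : 1 <= q ->
  (\int[lebesgue_measure]_(x in `]0%R, +oo[) (pdens x * (x + q ^+ 2)^-1)%:E =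
   ((q * (q + 1))^-1)%:E)%E.
Proof.
move=> q1.
have f0 (x : R) : 0 < x -> 0 <= pdens x * (x + q ^+ 2)^-1.
  by move=> x0; rewrite mulr_ge0 ?pdens_ge0// invr_ge0 addr_ge0 ?sqr_ge0// ltW.
have cf (x : R) : 0 < x ->
    {for x, continuous (fun x => pdens x * (x + q ^+ 2)^-1)}.
  move=> x0; apply: cvgM; first exact: continuous_pdens.
  by apply: continuous_addV; rewrite ltr_wpDl ?sqr_ge0.
have pi0 : pi != 0 :> R by rewrite gt_eqF ?pi_gt0.
move: q1; rewrite le_eqVlt => /predU1P[q1|q1].
  rewrite -q1 expr1n in f0 cf *.
  (* In [u = sqrt x], the derivative of [atan u + u / (1 + u^2)] is [2 / (1 + u^2)^2]. *)
  pose F (x : R) := pi^-1 * (atan (1 * Num.sqrt x) + Num.sqrt x * (x + 1)^-1).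
  have := @ge0_integral_itv0y _ F 0 2^-1 f0 cf.
  rewrite subr0 mul1r; apply.
  - move=> x x0; have s0 : 0 < Num.sqrt x by rewrite sqrtr_gt0.
    have sE : Num.sqrt x ^+ 2 = x by rewrite sqr_sqrtr// ltW.
    have x1 : x + 1 != 0 by rewrite gt_eqF// addr_gt0.
    have D0 : is_derive x 1 (fun x : R => x + 1) (1 + 0) by apply: is_deriveD.
    have D := @is_deriveV R (fun x => x + 1) x _ _ x1 D0.
    apply: (is_derive_eq (is_deriveZ pi^-1 (is_deriveD
      (is_derive_atan_sqrt 1 x0) (is_deriveM (is_derive1_sqrt x0) D)))).
    rewrite -![_ *: _]/(_ * _) /pdens.
    have {x1} : Num.sqrt x ^+ 2 + 1 != 0 by rewrite sE.
    (* Writing [x] as [Num.sqrt x ^+ 2] makes the identity rational in [Num.sqrt x], as [field]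
       requires. *)
    rewrite -[in X in X = _]sE -[in X in _ = X]sE !sqrtr_sqr (gtr0_norm s0).
    move: pi pi0 => c c0 x1; field.
    by rewrite c0 x1 gt_eqF.
  - rewrite -[X in _ --> X](_ : pi^-1 * (0 + 0 * (0 + 1)^-1) = _);
      last by rewrite mul0r addr0 mulr0.
    apply: cvgM; first exact: cvg_cst.
    apply: cvgD; first exact: cvg_atan_sqrt0.
    apply: cvg_at_right_filter; rewrite -{2}(@sqrtr0 R).
    apply: cvgM; first exact: sqrt_continuous.
    by apply: continuous_addV; rewrite addr0.
  - rewrite -[X in _ --> X](_ : pi^-1 * (pi / 2 + 0) = _);
      last by rewrite addr0 mulrA mulVf ?mul1r.
    apply: cvgM; first exact: cvg_cst.
    apply: cvgD; first exact: cvg_atan_sqrty.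
    apply: (@squeeze_cvgr _ _ _ _ (cst 0) (fun x => (Num.sqrt x)^-1)).
    + near=> x.
      have x0 : 0 < x by near: x; exact: nbhs_pinfty_gt.
      have s0 : 0 < Num.sqrt x by rewrite sqrtr_gt0.
      have sE : Num.sqrt x ^+ 2 = x by rewrite sqr_sqrtr// ltW.
      have x1 : 0 < x + 1 by rewrite addr_gt0.
      apply/andP; split=> /=; first by rewrite divr_ge0// ltW.
      rewrite ler_pdivrMr// -{3}sE expr2 mulrDr mulKf ?gt_eqF//.
      by rewrite lerDl mulr1 invr_ge0 ltW.
    + exact: cvg_cst.
    + apply/gtr0_cvgV0; last exact: cvgry_sqrt.
      near=> x; rewrite sqrtr_gt0.
      by near: x; exact: nbhs_pinfty_gt.
have q0 : 0 < q by rewrite (lt_trans _ q1).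
have q21 : q ^+ 2 - 1 != 0 by rewrite gt_eqF// subr_gt0 exprn_egt1.
(* Partial fractions in x; the case q = 1 above is the confluent one. *)
pose F (x : R) := 2 / (pi * (q ^+ 2 - 1)) *
  (atan (1 * Num.sqrt x) - q^-1 * atan (q^-1 * Num.sqrt x)).
have := @ge0_integral_itv0y _ F 0 (q * (q + 1))^-1 f0 cf.
rewrite subr0; apply.
- move=> x x0; have s0 : 0 < Num.sqrt x by rewrite sqrtr_gt0.
  apply: (is_derive_eq (is_deriveZ (2 / (pi * (q ^+ 2 - 1))) (is_deriveB
    (is_derive_atan_sqrt 1 x0) (is_deriveZ q^-1 (is_derive_atan_sqrt q^-1 x0))))).
  rewrite -![_ *: _]/(_ * _) /pdens.
  move: pi pi0 => c c0; field.
  by rewrite c0 q21 !gt_eqF ?addr_gt0// ?exprn_gt0.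
- rewrite -[X in _ --> X](_ : 2 / (pi * (q ^+ 2 - 1)) * (0 - q^-1 * 0) = _);
    last by rewrite mulr0 subr0 mulr0.
  apply: cvgM; first exact: cvg_cst.
  apply: cvgB; first exact: cvg_atan_sqrt0.
  by apply: cvgM; [exact: cvg_cst|exact: cvg_atan_sqrt0].
(* The limit is [(1 - 1/q) / (q^2 - 1)], that is [1 / (q (q + 1))]. *)
- rewrite -[X in _ --> X](_ :
    2 / (pi * (q ^+ 2 - 1)) * (pi / 2 - q^-1 * (pi / 2)) = _); last first.
    by move: pi pi0 => c c0; field; rewrite c0 q21 !gt_eqF// addr_gt0.
  apply: cvgM; first exact: cvg_cst.
  apply: cvgB; first exact: cvg_atan_sqrty.
  by apply: cvgM; [exact: cvg_cst|apply: cvg_atan_sqrty; rewrite invr_gt0].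
Unshelve. all: by end_near. Qed.
End integrals.

(** * Integrals of finite linear combinations *)

Section lincomb.
Context d (T : measurableType d) (R : realType).
Variables (mu : {measure set T -> \bar R}) (D : set T) (mD : measurable D).
Variables (I : finType) (a : I -> R) (F : I -> T -> R).
Hypothesis intF : forall i, mu.-integrable D (fun x => (F i x)%:E).

Let intaF i : mu.-integrable D (fun x => (a i * F i x)%:E).
Proof. by under eq_fun do rewrite EFinM; exact: integrableZl. Qed.

Lemma integrable_lincomb : mu.-integrable D (fun x => (\sum_i a i * F i x)%:E).
Proof. by under eq_fun do rewrite -sumEFin; apply: integrable_sum. Qed.

Lemma Rintegral_lincomb :
  \int[mu]_(x in D) (\sum_i a i * F i x) = \sum_i a i * \int[mu]_(x in D) F i x.
Proof.
rewrite /Rintegral; under eq_integral do rewrite -sumEFin.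
rewrite integral_sum// -sum_fine => [|i _]; last exact: integrable_fin_num.
by apply: eq_bigr => i _; exact: (RintegralZl _ mD (intF i)).
Qed.
End lincomb.

(** * Expectation and covariance of random matrices and vectors *)

Section expectation.
Context (R : realType) (disp : measure_display) (T : measurableType disp).
Variable P : probability T R.

(** The condition under which [mx_expectation] is linear: it excludes the entries to which [fine]
    would give a junk value. *)
Definition mx_Lfun1 m k (U : T -> 'M[R]_(m, k)) :=
  forall i j, (fun w => U w i j) \in Lfun P 1.

Lemma mx_expectationE m k (U : T -> 'M[R]_(m, k)) i j :
  mx_expectation P U i j = \int[P]_w U w i j.
Proof. by rewrite mxE unlock. Qed.

Lemma mx_Lfun1_mull m k l (A : 'M[R]_(m, k)) (U : T -> 'M[R]_(k, l)) :
  mx_Lfun1 U -> mx_Lfun1 (fun w => A *m U w).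
Proof.
move=> U1 i j; under eq_fun do rewrite mxE.
by apply/Lfun1_integrable/integrable_lincomb => // r; apply/Lfun1_integrable.
Qed.

Lemma mx_expectation_mull m k l (A : 'M[R]_(m, k)) (U : T -> 'M[R]_(k, l)) :
  mx_Lfun1 U -> mx_expectation P (fun w => A *m U w) = A *m mx_expectation P U.
Proof.
move=> U1; apply/matrixP => i j; rewrite mx_expectationE mxE.
under eq_Rintegral do rewrite mxE.
rewrite Rintegral_lincomb// => [|r]; last exact/Lfun1_integrable.
by apply: eq_bigr => r _; rewrite mx_expectationE.
Qed.

Lemma mx_Lfun1_tr m k (U : T -> 'M[R]_(m, k)) :
  mx_Lfun1 U -> mx_Lfun1 (fun w => (U w)^T).
Proof. by move=> U1 i j; under eq_fun do rewrite mxE; exact: U1. Qed.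

Lemma mx_expectation_tr m k (U : T -> 'M[R]_(m, k)) :
  mx_expectation P (fun w => (U w)^T) = (mx_expectation P U)^T.
Proof.
apply/matrixP => i j; rewrite [RHS]mxE !mx_expectationE.
by under eq_Rintegral do rewrite mxE.
Qed.

Lemma mx_Lfun1_mulr m k l (A : 'M[R]_(k, l)) (U : T -> 'M[R]_(m, k)) :
  mx_Lfun1 U -> mx_Lfun1 (fun w => U w *m A).
Proof.
move=> /mx_Lfun1_tr/(mx_Lfun1_mull A^T)/mx_Lfun1_tr.
by under [in X in X -> _]eq_fun do rewrite trmx_mul !trmxK.
Qed.

Lemma mx_expectation_mulr m k l (A : 'M[R]_(k, l)) (U : T -> 'M[R]_(m, k)) :
  mx_Lfun1 U -> mx_expectation P (fun w => U w *m A) = mx_expectation P U *m A.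
Proof.
move=> /mx_Lfun1_tr/(mx_expectation_mull A^T).
rewrite mx_expectation_tr -trmx_mul => /(congr1 trmx).
rewrite trmxK -mx_expectation_tr => <-.
by under [in RHS]eq_fun do rewrite trmx_mul !trmxK.
Qed.

Lemma mx_Lfun1B m k (U V : T -> 'M[R]_(m, k)) :
  mx_Lfun1 U -> mx_Lfun1 V -> mx_Lfun1 (fun w => U w - V w).
Proof.
move=> U1 V1 i j; under eq_fun do rewrite !mxE.
exact: rpredB (U1 i j) (V1 i j).
Qed.

Lemma mx_expectationB m k (U V : T -> 'M[R]_(m, k)) :
  mx_Lfun1 U -> mx_Lfun1 V ->
  mx_expectation P (fun w => U w - V w) =
    mx_expectation P U - mx_expectation P V.
Proof.
move=> U1 V1; apply/matrixP => i j; rewrite !mxE unlock -!/(Rintegral _ _ _).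
under eq_Rintegral do rewrite !mxE.
by rewrite RintegralB//; exact/Lfun1_integrable.
Qed.

Lemma mx_expectation_cst m k (A : 'M[R]_(m, k)) :
  mx_expectation P (fun=> A) = A.
Proof.
by apply/matrixP => i j; rewrite mxE (expectation_cst P (A i j)).
Qed.

Lemma finite_second_moments_Lfun1 k (U : T -> 'cV[R]_k) :
  finite_second_moments P U -> mx_Lfun1 U.
Proof.
move=> U2 i j; rewrite ord1; apply: Lfun_subset12 (U2 i).
by rewrite fin_num_measure.
Qed.

Lemma finite_second_momentsB k (U V : T -> 'cV[R]_k) :
  finite_second_moments P U -> finite_second_moments P V ->
  finite_second_moments P (fun w => U w - V w).
Proof.
move=> U2 V2 i; under eq_fun do rewrite !mxE.
by apply: rpredB => [|?|?]; [exact: lee1n|exact: U2|exact: V2].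
Qed.

Lemma finite_second_moments_cst k (a : 'cV[R]_k) :
  finite_second_moments P (fun=> a).
Proof. by move=> i; exact: Lfun_cst. Qed.

Lemma finite_second_moments_mull m k (A : 'M[R]_(m, k)) (U : T -> 'cV[R]_k) :
  finite_second_moments P U -> finite_second_moments P (fun w => A *m U w).
Proof.
move=> U2 i.
have -> : (fun w => (A *m U w) i 0) = \sum_j (A i j \o* (fun w => U w j 0)).
  apply/funext => w; rewrite mxE fct_sumE.
  by apply: eq_bigr => j _ /=; rewrite mulrC.
apply: rpred_sum => [|? j _]; first exact: lee1n.
by apply: Lfun_scale; [rewrite ler1n|exact: U2].
Qed.

(** Products of square-integrable functions are integrable, which opens covariances to the linearity
    of expectation. *)
Lemma mx_Lfun1_outer m k (U : T -> 'cV[R]_m) (V : T -> 'cV[R]_k) :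
  finite_second_moments P U -> finite_second_moments P V ->
  mx_Lfun1 (fun w => U w *m (V w)^T).
Proof.
move=> U2 V2 i j.
under eq_fun do rewrite mxE big_ord1 mxE.
exact: Lfun2_mul_Lfun1 (U2 i) (V2 j).
Qed.

Lemma tr_mx_covariance m k (U : T -> 'cV[R]_m) (V : T -> 'cV[R]_k) :
  (mx_covariance P U V)^T = mx_covariance P V U.
Proof.
rewrite /mx_covariance -mx_expectation_tr.
by under [in LHS]eq_fun do rewrite trmx_mul trmxK.
Qed.

(** The quadratic form is the expectation of the square of [x^T (U - E U)]. *)
Lemma mx_covariance_ge0 k (U : T -> 'cV[R]_k) (x : 'cV[R]_k) :
  finite_second_moments P U -> 0 <= (x^T *m mx_covariance P U U *m x) 0 0.
Proof.
move=> U2; have C2 := finite_second_momentsB U2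
  (finite_second_moments_cst (mx_expectation P U)).
have C1 := mx_Lfun1_outer C2 C2.
rewrite /mx_covariance -mx_expectation_mull// -mx_expectation_mulr;
  last exact: mx_Lfun1_mull.
rewrite mx_expectationE; apply: Rintegral_ge0 => w _.
set c := U w - _; have -> : x^T *m (c *m c^T) *m x = (x^T *m c) *m (x^T *m c)^T.
  by rewrite trmx_mul trmxK !mulmxA.
by rewrite mxE big_ord1 [X in _ * X]mxE -expr2 sqr_ge0.
Qed.

(** The theorem reduces to this once the integral over [s] is a fixed matrix [G] applied to [W_f].
    As [Z] is centered, its covariance is the expectation of [Z Z^T], which expands into four
    terms. *)
Lemma mx_covariance_centered_sub m k (X : T -> 'cV[R]_m) (Y : T -> 'cV[R]_k)
    (G : 'M[R]_(m, k)) :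
  finite_second_moments P X -> finite_second_moments P Y ->
  let Z := fun w => (X w - mx_expectation P X)
    - G *m (Y w - mx_expectation P Y) in
  [/\ finite_second_moments P Z, mx_expectation P Z = 0 &
    mx_covariance P Z Z = mx_covariance P X X - mx_covariance P X Y *m G^T
      - (G *m mx_covariance P Y X - G *m mx_covariance P Y Y *m G^T)].
Proof.
move=> X2 Y2 Z.
have cst2 l (a : 'cV[R]_l) := finite_second_moments_cst a.
have L1 l (U : T -> 'cV[R]_l) : finite_second_moments P U -> mx_Lfun1 U.
  exact: finite_second_moments_Lfun1.
have cX2 := finite_second_momentsB X2 (cst2 _ (mx_expectation P X)).
have cY2 := finite_second_momentsB Y2 (cst2 _ (mx_expectation P Y)).
have E0 l (U : T -> 'cV[R]_l) : finite_second_moments P U ->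
    mx_expectation P (fun w => U w - mx_expectation P U) = 0.
  by move=> U2; rewrite mx_expectationB ?mx_expectation_cst ?subrr//; exact: L1.
have Z2 : finite_second_moments P Z.
  by apply: finite_second_momentsB => //; exact: finite_second_moments_mull.
have EZ : mx_expectation P Z = 0.
  rewrite mx_expectationB ?mx_expectation_mull ?E0 ?mulmx0 ?subrr//;
    try exact: L1.
  by apply: L1; exact: finite_second_moments_mull.
split => //.
rewrite /mx_covariance EZ.
under eq_fun do rewrite subr0.
rewrite /Z.
pose U w := X w - mx_expectation P X; pose V w := Y w - mx_expectation P Y.
have XX := mx_Lfun1_outer cX2 cX2; have XY := mx_Lfun1_outer cX2 cY2.
have YX := mx_Lfun1_outer cY2 cX2; have YY := mx_Lfun1_outer cY2 cY2.
transitivity (mx_expectation P (fun w =>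
  (U w *m (U w)^T - U w *m (V w)^T *m G^T) -
  (G *m (V w *m (U w)^T) - G *m (V w *m (V w)^T) *m G^T))).
  have key (u : 'cV_m) (v : 'cV_k) : (u - G *m v) *m (u - G *m v)^T =
      (u *m u^T - u *m v^T *m G^T) -
      (G *m (v *m u^T) - G *m (v *m v^T) *m G^T).
    by rewrite raddfB/= trmx_mul mulmxBl !mulmxBr !mulmxA.
  by congr mx_expectation; apply/funext => w; exact: key.
have XYG := mx_Lfun1_mulr G^T XY; have GYX := mx_Lfun1_mull G YX.
have GYY := mx_Lfun1_mull G YY; have GYYG := mx_Lfun1_mulr G^T GYY.
have L := mx_Lfun1B XX XYG; have M := mx_Lfun1B GYX GYYG.
rewrite (mx_expectationB L M) (mx_expectationB XX XYG).
rewrite (mx_expectationB GYX GYYG).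
rewrite (mx_expectation_mulr G^T XY) (mx_expectation_mull G YX).
by rewrite (mx_expectation_mulr G^T GYY) (mx_expectation_mull G YY).
Qed.
End expectation.

(** * Entrywise integrals of matrix functions in a fixed eigenbasis *)

Section mx_integral.
Context {R : realType}.

(** Each entry of [L diag(v) M] is a linear form in [v] with coefficients [L_ir M_rj], so
    integration acts on the diagonal alone. *)
Lemma mx_integral_diag (D : set R) m n k (L : 'M[R]_(m, n)) (g : R -> 'rV[R]_n)
    (M : 'M[R]_(n, k)) (F : R -> 'M[R]_(m, k)) :
  measurable D -> mx_integrable D g ->
  (forall s, D s -> F s = L *m diag_mx (g s) *m M) ->
  mx_integrable D F /\
  mx_integral D F = L *m diag_mx (mx_integral D g) *m M.
Proof.
move=> mD ig FE.
have E (v : 'rV[R]_n) i j :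
    (L *m diag_mx v *m M) i j = \sum_r (L i r * M r j) * v 0 r.
  by rewrite mxE; apply: eq_bigr => r _; rewrite mul_mx_diag mxE mulrAC.
split => [i j|].
  have := @integrable_lincomb _ _ _ (@lebesgue_measure R) D mD _
    (fun r => L i r * M r j) (fun r s => g s 0 r) (ig 0).
  apply: eq_integrable => // s /[!inE] Ds.
  by rewrite FE// E.
apply/matrixP => i j; rewrite E mxE.
transitivity (\int[lebesgue_measure]_(s in D)
    (\sum_r (L i r * M r j) * g s 0 r)).
  by apply: eq_Rintegral => s /[!inE] Ds; rewrite FE// E.
rewrite Rintegral_lincomb//.
by apply: eq_bigr => r _; rewrite mxE.
Qed.

(** The integrand is nonnegative on the half-line, so its computed integral being finite
    suffices. *)
Lemma integrable_pdens_resolvent (q : R) : 1 <= q ->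
  (@lebesgue_measure R).-integrable `]0%R, +oo[
    (fun x => (pdens x * (x + q ^+ 2)^-1)%:E).
Proof.
move=> q1; apply/integrableP; split.
  apply/measurable_EFinP.
  apply: (@continuous_measurable_itv0y _
    (fun x => pdens x * (x + q ^+ 2)^-1)) => x x0.
  apply: cvgM; first exact: continuous_pdens.
  by apply: continuous_addV; rewrite ltr_wpDl ?sqr_ge0.
under eq_integral => x.
  rewrite inE/= in_itv/= andbT => x0.
  rewrite ger0_norm; last first.
    by rewrite mulr_ge0 ?pdens_ge0// invr_ge0 addr_ge0 ?sqr_ge0// ltW.
  over.
by rewrite integral_pdens_resolvent// ltry.
Qed.

End mx_integral.

(** * The averaged gain in closed form and the analysis covariance *)

Theorem theorem2 (R : realType) (disp : measure_display)
    (T : measurableType disp) (P : probability T R) (n d : nat)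
    (Xf : T -> 'cV[R]_n) (h : 'cV[R]_n -> 'cV[R]_d) (Robs : 'M[R]_d)
    (Xf2 : finite_second_moments P Xf)
    (hXf2 : finite_second_moments P (fun w => h (Xf w)))
    (Rpd : sym_posdef Robs) :
  let hXf := fun w => h (Xf w) in
  let Sxx := mx_covariance P Xf Xf in
  let Sxh := mx_covariance P Xf hXf in
  let Shh := mx_covariance P hXf hXf in
  let Zf := fun w => Xf w - mx_expectation P Xf in
  let Wf := fun w => hXf w - mx_expectation P hXf in
  let Sa := Sxx - Sxh *m invmx (Robs + Shh) *m Sxh^T in
  let K := fun s : R => Sxh *m invmx ((s + 1) *: Robs + Shh) in
  let p := fun s : R => (pi * Num.sqrt s * (s + 1))^-1 in
  let Za := fun w =>
    Zf w - mx_integral `]0, +oo[ (fun s => p s *: (K s *m Wf w)) in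
  (* all the objects of the statement are well defined *)
  [/\ Robs + Shh \in unitmx,
      (forall s : R, 0 < s -> (s + 1) *: Robs + Shh \in unitmx),
      probability_density_on `]0, +oo[ p,
      (forall w, mx_integrable `]0, +oo[ (fun s => p s *: (K s *m Wf w))) &
      finite_second_moments P Za] /\
  (mx_expectation P Za = 0 /\ mx_covariance P Za Za = Sa).
Proof.
move=> hXf Sxx Sxh Shh Zf Wf Sa K p Za.
have [Rs Rp] := Rpd.
have Ru : Robs \in unitmx by exact: posdef_unitmx.
have Hs : Shh^T = Shh by exact: tr_mx_covariance.
have Hp (x : 'cV[R]_d) : 0 <= (x^T *m Shh *m x) 0 0.
  exact: mx_covariance_ge0.
have [Q [l [Qu QE]]] := pencil_diagonalizable Rs Rp Hs.
have l0 := pencil_eig_ge0 Rs Ru Qu QE Rp Hp.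
pose F := pencil_fun Robs Q l.
(* One eigenbasis serves every [c]: [c = s + 1] gives the gains and [c = 1] the matrix inverted in
   [Sa]. *)
have pinv (c : R) : 0 < c -> c *: Robs + Shh \in unitmx /\
    invmx (c *: Robs + Shh) = F (fun x => (c + x)^-1).
  move=> c0; apply: (pencil_fun_inv Ru Qu QE) => i.
  by rewrite gt_eqF// ltr_wpDr.
have [RHu RHE] : Robs + Shh \in unitmx /\
    invmx (Robs + Shh) = F (fun x => (1 + x)^-1).
  by have := pinv 1 ltr01; rewrite scale1r.
pose q x : R := Num.sqrt (1 + x).
have q1 i : 1 <= q (l 0 i).
  by rewrite -{1}(@sqrtr1 R) ler_wsqrtr// lerDl.
have qE i : q (l 0 i) ^+ 2 = 1 + l 0 i by rewrite sqr_sqrtr// addr_ge0.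
pose m x := (q x * (q x + 1))^-1.
pose G := Sxh *m F m.
(* The spectrum of [p(s) (s + 1 + N)^-1], with [1 + l_i] written as a square to match the scalar
   integral. *)
pose g (s : R) : 'rV[R]_d := \row_i (pdens s * (s + q (l 0 i) ^+ 2)^-1).
have ig : mx_integrable `]0%R, +oo[ g.
  move=> i j.
  apply: eq_integrable (integrable_pdens_resolvent (q1 j)) => // s _.
  by rewrite mxE.
have Ig : mx_integral `]0%R, +oo[ g = map_mx m l.
  apply/rowP => i; rewrite !mxE.
  rewrite /m -[RHS]/(fine _%:E) -integral_pdens_resolvent//.
  by congr fine; apply: eq_integral => s _; rewrite mxE.
(* For fixed [w], only the diagonal factor depends on [s]. *)
have KE w s : `]0%R, +oo[%classic s -> p s *: (K s *m Wf w) =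
    (Sxh *m invmx Q) *m diag_mx (g s) *m (Q *m invmx Robs *m Wf w).
  rewrite /= in_itv/= andbT => s0; rewrite /K.
  have [|_ ->] := pinv (s + 1); first by rewrite addr_gt0.
  have -> : g s = p s *: map_mx (fun x => (s + 1 + x)^-1) l.
    by apply/rowP => i; rewrite !mxE qE addrA.
  by rewrite /F /pencil_fun linearZ/= -scalemxAr -scalemxAl !mulmxA.
have KI w := mx_integral_diag (measurable_itv _) ig (KE w).
(* The integral is evaluated pointwise in [w], so no interchange with the expectation arises. *)
have ZaE : Za = fun w => Zf w - G *m Wf w.
  apply/funext => w; rewrite /Za (KI w).2 Ig /G /F /pencil_fun.
  by rewrite !mulmxA.
have [Za2 EZa CZa] := mx_covariance_centered_sub G Xf2 hXf2.
rewrite -/hXf -/Zf -/Wf in Za2 EZa CZa.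
split; first split => //.
- by move=> s s0; have [] := pinv (s + 1); rewrite ?addr_gt0.
- split; last exact: integral_pdens.
    by apply: continuous_measurable_itv0y; exact: continuous_pdens.
  by move=> s /=; rewrite in_itv/= andbT; exact: pdens_ge0.
- by move=> w; exact: (KI w).1.
- by rewrite ZaE.
rewrite ZaE; split => //; rewrite CZa /Sa -/Sxx -/Sxh -/Shh.
have -> : mx_covariance P hXf Xf = Sxh^T by rewrite tr_mx_covariance.
have Fs : (F m)^T = F m by exact: tr_pencil_fun QE _.
(* The left side is grouped as in [CZa], after [Sxh] and its transpose are factored out. *)
have FE : F m - (F m *m Shh *m F m - F m) = invmx (Robs + Shh).
  rewrite RHE (pencil_fun_mulH Qu QE) !pencil_funB.
  apply: eq_pencil_fun => i; have := q1 i; have := qE i.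
  rewrite /m; set t := q _; move=> tE t1.
  (* In terms of [t] the identity is rational: [2 / (t (t + 1)) - (t^2 - 1) / (t (t + 1))^2 = 1 /
     t^2]. *)
  have -> : l 0 i = t ^+ 2 - 1 by rewrite tE addrC addKr.
  have t0 : t != 0 by rewrite gt_eqF// (lt_le_trans ltr01).
  have t10 : t + 1 != 0 by rewrite gt_eqF// addr_gt0// (lt_le_trans ltr01).
  by rewrite [1 + _]addrC subrK; field; rewrite t0 t10.
rewrite -FE /G trmx_mul Fs !mulmxBr !mulmxBl !mulmxA.
by rewrite !opprB !addrA; congr (_ - _); rewrite addrAC.
Qed.
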